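(* Let $H,G$ be finitely generated groups such that: 1. $H$ admits a translation-like action on $G$; 2. $H$ is finitely presented; 3. there exists a nonempty $H$-SFT on which the $H$-action is free. Then there exists a free $G$-chart $(X,\gamma)$ of $H$ such that $X$ is a nonempty $G$-SFT.
   Context: Groups are discrete. For a countable group $G$ and a finite set $\Sigma$, $\Sigma^G$ carries the product topology and the left action $(gx)(h)=x(hg)$. A $G$-subshift is a closed $G$-invariant subset of $\Sigma^G$ for some finite $\Sigma$. A pattern is an element $p\in\Sigma^F$ with $F\subset G$ finite, and $[p]=\{x\in\Sigma^G: x|_F=p\}$. A subshift $X\subset\Sigma^G$ is of finite type ($G$-SFT) if there is a finite set $\mathcal{F}$ of patterns with $X=\Sigma^G\setminus\bigcup_{p\in\mathcal{F},g\in G}g[p]$. Let $X$ be a $G$-subshift. An $H$-cocycle is a continuous map $\gamma\colon H\times X\to G$ with $\gamma(1_H,x)=1_G$ and $\gamma(h_1h_2,x)=\gamma(h_1,\gamma(h_2,x)x)\,\gamma(h_2,x)$ for all $h_1,h_2\in H$, $x\in X$. For each $x\in X$ it induces a left action of $H$ on the set $G$ by $h\cdot_x g=\gamma(h,gx)g$. The pair $(X,\gamma)$ is called a $G$-chart of $H$; it is a free $G$-chart if for every $x\in X$ the action $\cdot_x$ of $H$ on $G$ is free (that is, $h\cdot_x g=g$ for some $g$ implies $h=1_H$). An action of $H$ on a metric space $(M,d)$ is translation-like if it is free ($hm=m$ for some $m$ implies $h=1_H$) and bounded ($\sup_{m\in M}d(m,hm)<\infty$ for each $h\in H$). A finitely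 generated group $G$ is viewed as a metric space via a word metric, in the convention for which boundedness means: for each $h\in H$ the set $\{(h\cdot g)g^{-1}: g\in G\}$ is finite. *)

(* Defs.v *)
From HB Require Import structures.
From mathcomp Require Import all_boot finmap all_classical topology.

Set Implicit Arguments.
Unset Strict Implicit.
Unset Printing Implicit Defensive.

Local Open Scope classical_set_scope.
Local Open Scope group_scope.

(* The letter (i, b) stands for the i-th generator if b = false, and for its
   inverse if b = true. *)
Definition word (n : nat) := seq ('I_n * bool).

Definition winv n (w : word n) : word n := rev [seq (l.1, ~~ l.2) | l <- w].

Definition word_eval (G : groupType) n (s : 'I_n -> G) (w : word n) : G :=
  foldr (fun l g => (if l.2 then (s l.1)^-1 else s l.1) * g) 1 w.

Definition generates (G : groupType) n (s : 'I_n -> G) :=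
  forall g, exists w, word_eval s w = g.

Definition finitely_generated (G : groupType) :=
  exists n (s : 'I_n -> G), generates s.

(* The congruence on words whose quotient is the group < 'I_n | R >. *)
Inductive pres_eq n (R : seq (word n)) : word n -> word n -> Prop :=
| pres_refl u : pres_eq R u u
| pres_sym u v : pres_eq R u v -> pres_eq R v u
| pres_trans u v w : pres_eq R u v -> pres_eq R v w -> pres_eq R u w
| pres_cat u u' v v' :
    pres_eq R u u' -> pres_eq R v v' -> pres_eq R (u ++ v) (u' ++ v')
| pres_cancel i b : pres_eq R [:: (i, b); (i, ~~ b)] [::]
| pres_rel r : r \in R -> pres_eq R r [::].

Section presented_group.
Variables (n : nat) (R : seq (word n)).

Definition pres_eqb : rel (word n) := fun u v => `[< pres_eq R u v >].

Lemma pres_eqb_equiv : equiv_class_of pres_eqb.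
Proof.
split=> [u|u v|v u w].
- exact/asboolP/pres_refl.
- by apply/asboolP/asboolP => /pres_sym.
- by move=> /asboolP uv /asboolP vw; apply/asboolP; apply: pres_trans uv vw.
Qed.

Canonical pres_equiv := EquivRelPack pres_eqb_equiv.

Definition presented := {eq_quot pres_equiv}%qT.
HB.instance Definition _ := Choice.on presented.

Definition pres_class (w : word n) : presented := (\pi_presented w)%qT.
Definition pres_repr (x : presented) : word n := repr x.

Lemma pres_reprK : cancel pres_repr pres_class.
Proof. by move=> x; exact: reprK. Qed.

Lemma pres_classP u v : pres_class u = pres_class v <-> pres_eq R u v.
Proof.
split; first by move=> /eqmodP /asboolP.
by move=> uv; apply/eqmodP/asboolP.
Qed.

Lemma pres_class_repr w : pres_eq R (pres_repr (pres_class w)) w.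
Proof. by apply/pres_classP; rewrite pres_reprK. Qed.

Lemma winvK : involutive (@winv n).
Proof.
move=> w; rewrite /winv map_rev revK -map_comp map_id_in // => -[i b] _ /=.
by rewrite negbK.
Qed.

Lemma pres_mulwV w : pres_eq R (w ++ winv w) [::].
Proof.
elim: w => [|[i b] w IH]; first exact: pres_refl.
have -> : ((i, b) :: w) ++ winv ((i, b) :: w) =
    [:: (i, b)] ++ ((w ++ winv w) ++ [:: (i, ~~ b)]).
  by rewrite /winv map_cons rev_cons -cats1 -catA.
apply: pres_trans (pres_cancel R i b).
rewrite -[X in pres_eq _ _ X](cat1s (i, b)).
apply: pres_cat; first exact: pres_refl.
by apply: (@pres_cat _ _ _ [::]) => //; exact: pres_refl.
Qed.

Lemma pres_mulVw w : pres_eq R (winv w ++ w) [::].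
Proof. by have := pres_mulwV (winv w); rewrite winvK. Qed.

Lemma pres_inv u v : pres_eq R u v -> pres_eq R (winv u) (winv v).
Proof.
move=> uv; apply: (@pres_trans _ _ _ (winv u ++ (v ++ winv v))).
  rewrite -[X in pres_eq _ X _]cats0; apply: pres_cat; first exact: pres_refl.
  exact/pres_sym/pres_mulwV.
rewrite catA -[X in pres_eq _ _ X]cat0s.
apply: pres_cat; last exact: pres_refl.
apply: pres_trans (pres_mulVw u).
by apply: pres_cat; [exact: pres_refl|exact: pres_sym].
Qed.

Definition pres_mul (x y : presented) := pres_class (pres_repr x ++ pres_repr y).
Definition pres_one := pres_class [::].
Definition pres_invg (x : presented) := pres_class (winv (pres_repr x)).

Lemma pres_mulE u v : pres_mul (pres_class u) (pres_class v) = pres_class (u ++ v).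
Proof. by apply/pres_classP; apply: pres_cat; exact: pres_class_repr. Qed.

Lemma pres_invE u : pres_invg (pres_class u) = pres_class (winv u).
Proof. by apply/pres_classP/pres_inv; exact: pres_class_repr. Qed.

Fact pres_mulgA : associative pres_mul.
Proof.
move=> x y z; rewrite -(pres_reprK x) -(pres_reprK y) -(pres_reprK z).
by rewrite !pres_mulE catA.
Qed.

Fact pres_mul1g : left_id pres_one pres_mul.
Proof. by move=> x; rewrite -(pres_reprK x) pres_mulE. Qed.

Fact pres_mulg1 : right_id pres_one pres_mul.
Proof. by move=> x; rewrite -(pres_reprK x) pres_mulE cats0. Qed.

Fact pres_mulVg : left_inverse pres_one pres_invg pres_mul.
Proof.
move=> x; rewrite -(pres_reprK x) pres_invE pres_mulE.
exact/pres_classP/pres_mulVw.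
Qed.

Fact pres_mulgV : right_inverse pres_one pres_invg pres_mul.
Proof.
move=> x; rewrite -(pres_reprK x) pres_invE pres_mulE.
exact/pres_classP/pres_mulwV.
Qed.

HB.instance Definition _ := isGroup.Build presented
  pres_mulgA pres_mul1g pres_mulg1 pres_mulVg pres_mulgV.

End presented_group.

Definition finitely_presented (G : groupType) :=
  exists n (R : seq (word n)) (f : presented R -> G),
    bijective f /\ {morph f : x y / x * y}.

Definition is_left_action (H : groupType) (M : Type) (act : H -> M -> M) :=
  (forall m, act 1 m = m) /\
  (forall h1 h2 m, act (h1 * h2) m = act h1 (act h2 m)).

Definition free_action_on (H : groupType) (M : Type) (D : set M)
  (act : H -> M -> M) := forall h m, D m -> act h m = m -> h = 1.

(* Distances are nat-valued because only word metrics are needed. *)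
Definition translation_like (H : groupType) (M : Type) (d : M -> M -> nat)
    (act : H -> M -> M) :=
  [/\ is_left_action act,
      free_action_on setT act &
      forall h, exists N, forall m, (d m (act h m) <= N)%N].

(* The right-invariant word metric: the least length of a word with value
   h * g^-1 (a junk value if there is none, i.e. if s is not generating). *)
Definition word_dist (G : groupType) n (s : 'I_n -> G) (g h : G) : nat :=
  get [set k | (exists2 w, word_eval s w = h * g^-1 & size w = k) /\
               (forall w, word_eval s w = h * g^-1 -> (k <= size w)%N)].

Lemma word_distP (G : groupType) n (s : 'I_n -> G) (g h : G) : generates s ->
  (exists2 w, word_eval s w = h * g^-1 & size w = word_dist s g h) /\
  (forall w, word_eval s w = h * g^-1 -> (word_dist s g h <= size w)%N).
Proof.
move=> gs; rewrite /word_dist; case: xgetP => [k _ //|].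
have [w0 w0E] := gs (h * g^-1).
pose P k := `[< exists2 w, word_eval s w = h * g^-1 & size w = k >].
have exP : exists k, P k by exists (size w0); apply/asboolP; exists w0.
have [m /asboolP Pm min] := ex_minnP exP.
move=> /(_ m) []; split=> // w wE.
by apply: min; apply/asboolP; exists w.
Qed.

Lemma finite_words n N : finite_set [set w : word n | (size w <= N)%N].
Proof.
elim: N => [|N IH].
  by apply: sub_finite_set (finite_set1 [::]) => -[].
pose f (l : 'I_n * bool) (w : word n) : word n := l :: w.
have fin : finite_set ([set [::]] `|`
    [set f l w | l in setT & w in [set w : word n | (size w <= N)%N]]).
  rewrite finite_setU; split; first exact: finite_set1.
  exact: finite_image2.
apply: sub_finite_set fin => -[_|l w] /=; first by left.
by move=> wN; right; exists l => //; exists w.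
Qed.

(* In this metric an action is bounded exactly when, for each h, the set of
   the displacements (h . g) g^-1 is finite. *)
Lemma bounded_word_distP (H G : groupType) n (s : 'I_n -> G)
    (act : H -> G -> G) (h : H) : generates s ->
  (exists N, forall g, (word_dist s g (act h g) <= N)%N) <->
  finite_set (range (fun g => act h g * g^-1)).
Proof.
move=> gs; split=> [[N dN]|/finite_seqP [r rE]].
  have finW := finite_words n N.
  apply: sub_finite_set (finite_image (word_eval s) finW) => _ [g _ <-].
  have [[w wE ws] _] := word_distP g (act h g) gs.
  by exists w => //=; rewrite ws.
have [w wE] : exists w : G -> word n, forall x, word_eval s (w x) = x.
  by exists (fun x => xget [::] [set u | word_eval s u = x]) => x;
     case: xgetP => // noW; have [u uE] := gs x; have := noW u.
exists (\max_(x <- r) size (w x)) => g.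
have [_ /(_ _ (wE _)) le] := word_distP g (act h g) gs.
apply: leq_trans le _.
have gr : act h g * g^-1 \in r.
  by have : [set` r] (act h g * g^-1) by rewrite -rE; exists g.
by rewrite (big_rem _ gr) leq_maxl.
Qed.

Definition config (G : groupType) (A : finType) :=
  {ptws G -> discrete_topology A}.

Definition shift (G : groupType) (A : finType) (g : G) (x : config G A) :
  config G A := fun h => x (h * g).

Definition is_subshift (G : groupType) (A : finType) (X : set (config G A)) :=
  closed X /\ forall g x, X x -> X (shift g x).

Definition cylinder (G : groupType) (A : finType) (p : {fmap G -> A}) :
  set (config G A) := [set x | forall g a, p.[? g]%fmap = Some a -> x g = a].

Definition is_sft (G : groupType) (A : finType) (X : set (config G A)) :=
  is_subshift X /\ exists F : {fset {fmap G -> A}},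
    X = ~` \bigcup_(p in [set` F]) \bigcup_(g in setT) (shift g @` cylinder p).

Definition is_cocycle (H G : groupType) (A : finType) (X : set (config G A))
    (gamma : H -> config G A -> G) :=
  [/\ {within [set: discrete_topology H] `*` X, continuous
        (fun hx => gamma hx.1 hx.2 : discrete_topology G)},
      forall x, X x -> gamma 1 x = 1 &
      forall h1 h2 x, X x ->
        gamma (h1 * h2) x = gamma h1 (shift (gamma h2 x) x) * gamma h2 x].

Definition cocycle_act (H G : groupType) (A : finType)
    (gamma : H -> config G A -> G) (x : config G A) (h : H) (g : G) : G :=
  gamma h (shift g x) * g.

(* Only the values of gamma on H x X matter. *)
Definition is_chart (H G : groupType) (A : finType) (X : set (config G A))
    (gamma : H -> config G A -> G) := is_subshift X /\ is_cocycle X gamma.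

Definition is_free_chart (H G : groupType) (A : finType) (X : set (config G A))
    (gamma : H -> config G A -> G) :=
  is_chart X gamma /\
  forall x, X x -> free_action_on setT (cocycle_act gamma x).

(* Main.v *)
Require Import Defs.
From mathcomp Require Import all_boot finmap all_classical topology.

(* By boundedness a translation-like action of H on G is encoded by a
   configuration on G that records, at each g, the displacement of g by every
   generator of H. As H is finitely presented, being such an encoding is a local
   rule: following a relator must lead back to the start. A second layer of
   letters is constrained so that, read along each H-orbit, it is a point of the
   given H-SFT; this is again local. The cocycle reads off where h moves 1. If h
   fixes a point, it fixes the H-configuration read along its orbit, so h = 1.
   Freeness of the translation-like action lets one copy a point of the H-SFT
   onto every orbit, whence a point of the G-SFT. *)

Set Implicit Arguments.
Unset Strict Implicit.
Unset Printing Implicit Defensive.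

Local Open Scope classical_set_scope.
Local Open Scope group_scope.

(** * Functions with a finite window, and subshifts of finite type *)

Section local_functions.
Variables (G : groupType) (A : finType).
Implicit Types (x y : config G A) (W : {fset G}).

Lemma shiftM g h x : shift (g * h) x = shift g (shift h x).
Proof. by apply/funext => k; rewrite /shift mulgA. Qed.

Lemma shift1 x : shift 1 x = x.
Proof. by apply/funext => k; rewrite /shift mulg1. Qed.

(** One window serves all configurations. With [T := Prop] this covers local rules. *)
Definition local T (phi : config G A -> T) :=
  exists W : {fset G}, forall x y, {in W, x =1 y} -> phi x = phi y.

Lemma local_comp T U (f : T -> U) (phi : config G A -> T) :
  local phi -> local (f \o phi).
Proof. by move=> [W loc]; exists W => x y /loc /= ->. Qed.

Lemma local_and (P Q : config G A -> Prop) :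
  local P -> local Q -> local (fun x => P x /\ Q x).
Proof.
move=> [V locP] [W locQ]; exists (V `|` W)%fset => x y xy.
rewrite (locP x y) ?(locQ x y) // => g gVW.
  by apply: xy; rewrite inE gVW orbT.
by apply: xy; rewrite inE gVW.
Qed.

Lemma local_all (I : eqType) (s : seq I) (P : I -> config G A -> Prop) :
  (forall i, local (P i)) -> local (fun x => forall i, i \in s -> P i x).
Proof.
move=> locP; elim: s => [|i s [V locs]].
  by exists fset0 => x y _; apply/propext; split.
have [W loci] := locP i.
exists (V `|` W)%fset => x y xy; apply/propext.
have eqi : P i x = P i y.
  by apply: loci => g gW; apply: xy; rewrite inE gW orbT.
have eqs : (forall j, j \in s -> P j x) = (forall j, j \in s -> P j y).
  by apply: locs => g gV; apply: xy; rewrite inE gV.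
have consE z : (forall j, j \in i :: s -> P j z) <->
    P i z /\ forall j, j \in s -> P j z.
  split=> [all_s|[Pi all_s] j].
    by split=> [|j js]; apply: all_s; rewrite inE ?eqxx // js orbT.
  by rewrite inE => /predU1P [->|/all_s].
by rewrite !consE eqi eqs.
Qed.

Definition restriction W x : {fmap G -> A} := [fmap g : W => (x (val g) : A)]%fmap.

Lemma cylinder_restriction W x y :
  cylinder (restriction W x) y <-> {in W, x =1 y}.
Proof.
split=> [cyl g gW|xy g a].
  by rewrite (cyl g (x g)) //; apply/fndSomeP; exists gW; rewrite ffunE.
by move=> /fndSomeP [gW]; rewrite ffunE /= => <-; rewrite xy.
Qed.

#[local] Instance config_nbhs_filter x : Filter (nbhs x) := nbhs_filter x.

Lemma nbhs_agree (W : seq G) x : nbhs x [set y | {in W, x =1 y}].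
Proof.
elim: W => [|g W IH]; first by apply: filterS filterT => y _ g.
have ng : nbhs x [set y : config G A | x g = y g].
  have := @proj_continuous G (fun _ => discrete_topology A) g x.
  by apply; apply: filterS (discrete_set1 _) => a ->.
apply: filterS (filterI ng IH) => y [/= xyg xyW] h.
by rewrite inE => /predU1P [->|/xyW].
Qed.

Lemma local_nbhs T (phi : config G A -> T) x :
  local phi -> nbhs x [set y | phi x = phi y].
Proof.
by move=> [W loc]; apply: filterS (nbhs_agree W x) => y /loc.
Qed.

Lemma local_shift T (phi : config G A -> T) g :
  local phi -> local (fun x => phi (shift g x)).
Proof.
move=> [W loc]; exists [fset h * g | h in W]%fset => x y xy.
by apply: loc => h hW; apply: xy; apply/imfsetP; exists h.
Qed.

(** Forbid the restrictions to the window of all configurations violating [P]; there are finitely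
    many, as [A] and the window are finite. *)
Lemma sft_of_local (P : config G A -> Prop) :
  local P -> is_sft [set x | forall g, P (shift g x)].
Proof.
move=> locP; split; first split.
- rewrite -openC openE => x /= nx; have [g ng] : exists g, ~ P (shift g x).
    exact/existsNP.
  apply: filterS (local_nbhs x (local_shift g locP)) => y /= xy Py.
  by apply: ng; rewrite xy.
- by move=> g x Px h; rewrite -shiftM.
have [W loc] := locP.
pose S := [set p | exists2 y, ~ P y & p = restriction W y].
have /finite_fsetP [F FE] : finite_set S.
  pose fmap_of (f : {ffun W -> A}) : {fmap G -> A} := [fmap g : W => f g]%fmap.
  have fin : finite_set [set: {ffun W -> A}] by exact: finite_finset.
  apply: sub_finite_set (finite_image fmap_of fin) => _ [y _ ->].
  exists [ffun g : W => (y (val g) : A)] => //; apply/fmapP => g.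
  case: fndP => gW; last by rewrite not_fnd.
  by rewrite in_fnd !ffunE.
exists F; rewrite -FE; apply/seteqP; split=> x.
  move=> Px [_ [y nPy ->]] [g _ [z /cylinder_restriction yz] zx].
  have := Px g^-1; rewrite -zx -shiftM mulVg shift1.
  by rewrite -(loc y z).
move=> nx g; apply: contrapT => nP; apply: nx.
exists (restriction W (shift g x)); first by exists (shift g x).
exists g^-1 => //; exists (shift g x); first exact/cylinder_restriction.
by rewrite -shiftM mulVg shift1.
Qed.

End local_functions.

(** * Forbidden patterns, and words representing group elements *)

Lemma forbidden_patternsP (G : groupType) (A : finType) (X : set (config G A))
    (F : {fset {fmap G -> A}}) :
  X = ~` (\bigcup_(p in [set` F]) \bigcup_(g in setT) (shift g @` cylinder p)) ->
  forall x, X x <-> forall g p, p \in F -> ~ cylinder p (shift g x).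
Proof.
move=> -> x; split=> [nx g p pF cyl|cyl [p pF] [g _ [z pz zx]]].
  apply: nx; exists p => //; exists g^-1 => //; exists (shift g x) => //.
  by rewrite -shiftM mulVg shift1.
by apply: (cyl g^-1 p pF); rewrite -zx -shiftM mulVg shift1.
Qed.

(** A finite conjunction over the domain of [p], the form to which [local_all] applies. *)
Lemma cylinderE (G : groupType) (A : finType) (p : {fmap G -> A})
    (x : config G A) :
  cylinder p x <-> forall g, g \in (domf p : seq G) -> p.[? g]%fmap = Some (x g).
Proof.
split=> [cyl g gp|px g a pg]; first by rewrite in_fnd (cyl _ _ (in_fnd gp)).
have gp : g \in domf p by move/fndSomeP: pg => [].
by have := px g gp; rewrite pg => -[].
Qed.

Lemma finitely_presentedP (H : groupType) : finitely_presented H ->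
  exists n (R : seq (word n)) (ev : word n -> H) (w : H -> word n),
    [/\ ev [::] = 1, {morph ev : u v / u ++ v >-> u * v}, cancel w ev &
        forall u v, ev u = ev v <-> pres_eq R u v].
Proof.
move=> [n [R [f [[f' fK f'K] fM]]]].
exists n, R, (fun u => f (pres_class R u)), (fun h => pres_repr (f' h)); split.
- apply: (@mulgI _ (f (pres_class R [::]))).
  by rewrite mulg1 -fM -[_ * _]/(pres_mul _ _) pres_mulE.
- by move=> u v; rewrite -fM -[_ * _]/(pres_mul _ _) pres_mulE.
- by move=> h; rewrite pres_reprK f'K.
- by move=> u v; rewrite -pres_classP; split=> [/(can_inj fK)|->].
Qed.

(** * Walks steered by the letters of a configuration *)

Section walks.
Variables (G : groupType) (A : finType) (n : nat) (D : {fset G}).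

(* Along an orbit, the first component of the letter at g tells how far each
   generator moves g, and the second one is the letter of the H-SFT. *)
Definition alphabet : finType := ({ffun 'I_n * bool -> D} * A)%type.
Implicit Types x : config G alphabet.

(** The last letter of the word moves first, as in a left action. *)
Definition walk x (g : G) (w : word n) : G :=
  foldr (fun l p => val ((x p).1 l) * p) g w.

Lemma walk_cat x g u v : walk x g (u ++ v) = walk x (walk x g v) u.
Proof. exact: foldr_cat. Qed.

(** Displacements multiply on the left and the shift translates on the right, so the two commute. *)
Lemma walk_shift x g h w : walk x (g * h) w = walk (shift h x) g w * h.
Proof. by elim: w => //= l w ->; rewrite mulgA. Qed.

Lemma walk_shift1 x g w : walk x g w = walk (shift g x) 1 w * g.
Proof. by rewrite -walk_shift mul1g. Qed.

(** The places visited depend on [x], but all displacements lie in the finite set [D]. The induction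
    therefore also keeps the endpoint inside the window, where the next letter is read. *)
Lemma walk_window w : exists W : {fset G},
  (forall x, walk x 1 w \in W) /\
  (forall x y, {in W, x =1 y} -> walk x 1 w = walk y 1 w).
Proof.
elim: w => [|l w [W [inW loc]]].
  by exists [fset 1]%fset; split=> // x; rewrite inE.
exists (W `|` [fset d * p | d in D, p in W])%fset; split=> [x|x y xy] /=.
  rewrite inE; apply/orP; right; apply/imfset2P.
  by exists (val ((x (walk x 1 w)).1 l)); [exact: valP|exists (walk x 1 w)].
rewrite -(loc x y) => [|g gW]; last by apply: xy; rewrite inE gW.
by rewrite xy // inE inW.
Qed.

Lemma local_walk w : local (fun x => walk x 1 w).
Proof. by have [W [_ loc]] := walk_window w; exists W. Qed.

Lemma local_walk_letter w : local (fun x => x (walk x 1 w)).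
Proof.
have [W [inW loc]] := walk_window w; exists W => x y xy.
by rewrite -(loc x y) // xy.
Qed.

(** Words inducing the same self-map of [G] form a congruence, so it suffices to check the
    generating pairs of [pres_eq]. *)
Lemma walk_pres_eq (R : seq (word n)) x :
  (forall g r, r \in R -> walk x g r = g) ->
  (forall g i b, walk x g [:: (i, b); (i, ~~ b)] = g) ->
  forall u v, pres_eq R u v -> forall g, walk x g u = walk x g v.
Proof.
move=> walkR walkV u v.
elim=> // [{}u w {}v _ uw _ wv g|u1 u2 v1 v2 _ u12 _ v12 g|r rR g].
- by rewrite uw.
- by rewrite !walk_cat v12 u12.
- exact: walkR.
Qed.

End walks.

(** * The chart: its space, its cocycle and freeness *)

Section chart.
Variables (H G : groupType) (A : finType) (n : nat) (R : seq (word n)).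
Variables (ev : word n -> H) (w : H -> word n) (D : {fset G}).
Hypotheses (ev_nil : ev [::] = 1) (evM : {morph ev : u v / u ++ v >-> u * v}).
Hypotheses (wK : cancel w ev) (evP : forall u v, ev u = ev v <-> pres_eq R u v).
Variables (F : {fset {fmap H -> A}}) (Y : set (config H A)).
Hypothesis YP : forall y, Y y <-> forall h p, p \in F -> ~ cylinder p (shift h y).
Implicit Types x : config G (alphabet A n D).

(** An inverse letter carries a displacement of its own, so cancellation has to be imposed too. *)
Definition relators : seq (word n) :=
  R ++ [seq [:: l; (l.1, ~~ l.2)] | l <- enum {: 'I_n * bool}].

Definition orbit_config x (g : G) : config H A := fun h => (x (walk x g (w h))).2.

Definition chart_rule x : Prop :=
  (forall r, r \in relators -> walk x 1 r = 1) /\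
  (forall p, p \in (F : seq _) -> ~ cylinder p (orbit_config x 1)).

Definition chart_space : set (config G (alphabet A n D)) :=
  [set x | forall g, chart_rule (shift g x)].

Definition chart_cocycle (h : H) x : G := walk x 1 (w h).

Lemma local_chart_rule : local chart_rule.
Proof.
apply: local_and; apply: local_all; last move=> p.
  by move=> r; apply: (local_comp (fun g => g = 1)); exact: local_walk.
apply: (local_comp not).
have -> : (fun x => cylinder p (orbit_config x 1)) =
    (fun x => forall h, h \in (domf p : seq H) ->
       p.[? h]%fmap = Some (orbit_config x 1 h)).
  by apply/funext => x; apply/propext; exact: cylinderE.
apply: local_all => h.
apply: (local_comp (fun a : alphabet A n D => p.[? h]%fmap = Some a.2)).
exact: local_walk_letter.
Qed.

Lemma chart_space_sft : is_sft chart_space.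
Proof. exact/sft_of_local/local_chart_rule. Qed.

Lemma orbit_config_shift1 x g : orbit_config x g = orbit_config (shift g x) 1.
Proof. by apply/funext => h; rewrite /orbit_config walk_shift1. Qed.

(** The rule at every shift makes relators close up at every point, so walks define an action of [H]
    on [G]. *)
Lemma walk_ev x u v g : chart_space x -> ev u = ev v -> walk x g u = walk x g v.
Proof.
move=> Xx /evP uv; have walkR k r : r \in relators -> walk x k r = k.
  by move=> rR; have [rel _] := Xx k; rewrite walk_shift1 rel // mul1g.
apply: walk_pres_eq uv g => [g r rR|g i b]; apply: walkR; rewrite mem_cat.
  by rewrite rR.
by apply/orP; right; apply/mapP; exists (i, b) => //; rewrite mem_enum.
Qed.

Lemma walkM x g h k : chart_space x ->
  walk x g (w (h * k)) = walk x (walk x g (w k)) (w h).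
Proof.
by move=> Xx; rewrite -walk_cat; apply: walk_ev => //; rewrite evM !wK.
Qed.

Lemma shift_orbit_config x g h : chart_space x ->
  shift h (orbit_config x g) = orbit_config x (walk x g (w h)).
Proof.
by move=> Xx; apply/funext => k; rewrite /shift /orbit_config walkM.
Qed.

(** A pattern occurring at [h] would occur at the identity in the configuration read from
    [walk x g (w h)], where the rule excludes it. *)
Lemma orbit_config_mem x g : chart_space x -> Y (orbit_config x g).
Proof.
move=> Xx; apply/YP => h p pF; rewrite shift_orbit_config // orbit_config_shift1.
by have [_] := Xx (walk x g (w h)); exact.
Qed.

Lemma chart_cocycle_continuous :
  continuous (fun hx : discrete_topology H * config G (alphabet A n D) =>
    chart_cocycle hx.1 hx.2 : discrete_topology G).
Proof.
move=> [h x]; apply/discrete_cvg.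
exists ([set h], [set y | walk x 1 (w h) = walk y 1 (w h)]).
  split; first exact: discrete_set1.
  exact: (local_nbhs x (local_walk A D (w h))).
by move=> [k y] [/= -> ] xy; rewrite /chart_cocycle.
Qed.

Lemma chart_cocycle_is_cocycle : is_cocycle chart_space chart_cocycle.
Proof.
split=> [|x Xx|h k x Xx].
- exact/continuous_subspaceT/chart_cocycle_continuous.
(* The chosen word [w 1] may be nonempty, but it evaluates to 1 as the empty word does. *)
- by rewrite /chart_cocycle (@walk_ev _ _ [::]) // wK ev_nil.
- by rewrite /chart_cocycle walkM // walk_shift1.
Qed.

Lemma chart_cocycle_free x : free_action_on Y (@shift H A) -> chart_space x ->
  free_action_on setT (cocycle_act chart_cocycle x).
Proof.
move=> freeY Xx h g _; rewrite /cocycle_act /chart_cocycle -walk_shift1 => fix_g.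
apply: (freeY h (orbit_config x g)); first exact: orbit_config_mem.
by rewrite shift_orbit_config // fix_g.
Qed.

(** * A point of the chart space from a translation-like action *)

Section realization.
Variable act : H -> G -> G.
Hypotheses (act_action : is_left_action act) (act_free : free_action_on setT act).
Hypothesis act_D : forall l g, act (ev [:: l]) g * g^-1 \in D.

Lemma free_action_inj g : injective (act ^~ g).
Proof.
case: act_action => act1 actM h k hk.
have /act_free : act (k^-1 * h) g = g by rewrite actM hk -actM mulVg act1.
by move=> /(_ I) /(congr1 ( *%g k)); rewrite mulgA mulgV mul1g mulg1.
Qed.

Lemma orbit_coordinates : exists t : G -> H, forall h g, t (act h g) = h * t g.
Proof.
case: act_action => act1 actM.
(* The base point depends on [g] only through the set [orbit g], hence is constant along orbits. The
   coordinate [t g] carries the base point to [g], and freeness makes it unique. *)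
pose orbit g := [set g' | exists h, act h g' = g].
pose base g := xget 1 (orbit g).
have baseP g : exists h, act h (base g) = g.
  by rewrite /base; case: xgetP => // /(_ g); case; exists 1.
have [t tP] := @choice _ _ (fun g h => act h (base g) = g) baseP.
exists t => h g; apply: (@free_action_inj (base g)).
suff baseE : base (act h g) = base g by rewrite actM tP -{1}baseE tP.
congr (xget 1 _); apply/seteqP; split=> g' [k kg'].
  by exists (h^-1 * k); rewrite actM kg' -actM mulVg act1.
by exists (h * k); rewrite actM kg'.
Qed.

Lemma chart_space_nonempty : Y !=set0 -> chart_space !=set0.
Proof.
case: act_action => act1 actM [y0 Yy0]; have [t tM] := orbit_coordinates.
(* Since [t] is equivariant, reading [y0 \o t] along the orbit of [g] gives a shift of [y0]. *)
pose x : config G (alphabet A n D) :=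
  fun g => ([ffun l => [` act_D l g]%fset], y0 (t g) : A).
have walkE g u : walk x g u = act (ev u) g.
  elim: u => [|l u IH]; first by rewrite ev_nil act1.
  by rewrite -cat1s evM actM /= IH ffunE /= mulgVK.
have orbitE g : orbit_config x g = shift (t g) y0.
  by apply/funext => h; rewrite /orbit_config walkE wK /= tM.
exists x => g; split=> [r rR|p pF].
  apply: (@mulIg _ g); rewrite -walk_shift1 walkE mul1g.
  suff -> : ev r = 1 by rewrite act1.
  rewrite -ev_nil; apply/evP; move: rR; rewrite mem_cat => /orP [|/mapP [[i b] _ ->]].
    exact: pres_rel.
  exact: pres_cancel.
by rewrite -orbit_config_shift1 orbitE; move/YP: Yy0; apply.
Qed.

End realization.
End chart.

Theorem proposition3p23 (H G : groupType)
  (fgH : finitely_generated H) (fgG : finitely_generated G)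
  (translation_like_HG : exists n (s : 'I_n -> G) (act : H -> G -> G),
     generates s /\ translation_like (word_dist s) act)
  (fpH : finitely_presented H)
  (free_sft_H : exists (A : finType) (Y : set (config H A)),
     [/\ is_sft Y, Y !=set0 & free_action_on Y (@shift H A)]) :
  exists (B : finType) (X : set (config G B)) (gamma : H -> config G B -> G),
    [/\ is_free_chart X gamma, is_sft X & X !=set0].
Proof.
have [m [s [act [gs [act_action act_free act_bounded]]]]] := translation_like_HG.
have [n [R [ev [w [ev_nil evM wK evP]]]]] := finitely_presentedP fpH.
have [A [Y [[_ [F YF]] Y0 freeY]]] := free_sft_H.
have YP := forbidden_patternsP YF.
(* [D] collects the displacements by all letters of the presentation of [H], inverses included;
   boundedness makes it finite. *)
have /finite_fsetP [D DE] : finite_set (\bigcup_(l in [set: 'I_n * bool])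
    range (fun g => act (ev [:: l]) g * g^-1)).
  apply: bigcup_finite => [|l _]; first exact: finite_finset.
  exact/(bounded_word_distP act (ev [:: l]) gs).
have act_D l g : act (ev [:: l]) g * g^-1 \in D.
  suff : [set` D] (act (ev [:: l]) g * g^-1) by [].
  by rewrite -DE; exists l => //; exists g.
have sftX := chart_space_sft R w D F.
exists (alphabet A n D), (chart_space R w F), (@chart_cocycle _ _ _ _ w D); split=> //.
- split; last by move=> x; exact: (chart_cocycle_free evM wK evP YP freeY).
  split; first by case: sftX.
  exact: (@chart_cocycle_is_cocycle H G A n R ev w D ev_nil evM wK evP F).
- exact: (chart_space_nonempty ev_nil evM wK evP YP act_action act_free act_D Y0).
Qed.
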